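(* Let $X$ and $Y$ be Banach spaces such that $X^*$ is separable and $Y$ has an unconditional Schauder basis with unconditional constant less than $2$. Then any linear subspace $E$ of $\mathcal{B}(X,Y)$ containing $\mathcal{F}(X,Y)$ has the uniform ball covering property (UBCP).
   Context: $\mathcal{B}(X,Y)$ is the space of bounded linear operators from $X$ to $Y$ with the operator norm, and $\mathcal{F}(X,Y)$ is its subspace of finite-rank operators. The subspace $E$ carries the operator norm. A normed space $Z$ has the uniform ball covering property (UBCP) if there are points $z_i\in Z$ and radii $r_i>0$ ($i\in\mathbb{N}$) and constants $R,\delta>0$ such that the unit sphere $\{z\in Z:\|z\|=1\}$ is covered by the open balls $B(z_i,r_i)$, and $r_i\le R$ and $\|z_i\|-r_i>\delta$ for all $i$. A Schauder basis $(e_n)_{n\in\mathbb{N}}$ is unconditional if there is a constant $C\ge 1$ such that $\|\sum a_ne_n\|\le C\|\sum b_ne_n\|$ for all scalar sequences $(a_n),(b_n)$ with $|a_n|\le|b_n|$ for all $n$ (for which the series converge); the best such $C$ is called its unconditional constant. *)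

(* Defs.v *)
From HB Require Import structures.
From mathcomp Require Import all_boot all_order all_algebra.
From mathcomp Require Import all_classical all_reals all_analysis.
From mathcomp Require Import complex.

Set Implicit Arguments.
Unset Strict Implicit.
Unset Printing Implicit Defensive.

Import Order.TTheory GRing.Theory Num.Theory.
Import numFieldNormedType.Exports.

Local Open Scope classical_set_scope.
Local Open Scope ring_scope.

(* A uniform treatment of real and complex Banach spaces: [scalars k R] is
   either the field R of real numbers or the field R[i] of complex numbers.
   Norms of a [normedModType K] take values in K; for K = R[i] they are complex
   numbers with zero imaginary part, and on R[i] the order x <= y compares real
   parts and requires equal imaginary parts.  Hence positive elements of K, and
   elements bounded below by 1, are real in both cases. *)
Variant scalar_kind := RealScalars | ComplexScalars.

Definition scalars (k : scalar_kind) (R : realType) : numFieldType :=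
  match k with
  | RealScalars => R
  | ComplexScalars => R[i]
  end.

Definition real_part {k : scalar_kind} {R : realType} : scalars k R -> R :=
  match k return scalars k R -> R with
  | RealScalars => fun x : R => x
  | ComplexScalars => @complex.Re R
  end.

Definition of_real {k : scalar_kind} {R : realType} : R -> scalars k R :=
  match k return R -> scalars k R with
  | RealScalars => fun x : R => x
  | ComplexScalars => fun x => Complex x 0
  end.

Section scalars_theory.
Context {k : scalar_kind} {R : realType}.
Local Notation K := (scalars k R).

Lemma of_real0 : of_real 0 = 0 :> K.
Proof. by case: k. Qed.

Lemma of_real_le (x y : R) : ((of_real x : K) <= of_real y) = (x <= y).
Proof. by case: k => //=; rewrite lecR. Qed.

Lemma real_partK (x : K) : 0 <= x -> of_real (real_part x) = x.
Proof. by case: k x => //= -[a b]; rewrite lecE /= => /andP[/eqP -> _]. Qed.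

End scalars_theory.

Section bounded_operators.
Context {K : numFieldType}.
Implicit Types X Y : normedModType K.

Definition bounded_linear_op {X Y} : {pred X -> Y} :=
  fun f => `[< linear f /\ exists M : K, forall x, `|f x| <= M * `|x| >].

Lemma bounded_linear_op_submod X Y : submod_closed (@bounded_linear_op X Y).
Proof.
split.
  apply/asboolP; split; first by move=> a x y; rewrite /= scaler0 addr0.
  by exists 0 => x; rewrite normr0 mul0r.
move=> a f g /asboolP[lf [M fM]] /asboolP[lg [N gN]]; apply/asboolP; split.
  move=> c x y.
  rewrite !fctE lf lg !scalerDr !scalerA [a * c]mulrC -!addrA; congr (_ + _).
  by rewrite addrCA.
exists (`|a| * M + N) => x; rewrite mulrDl -mulrA.
apply: (le_trans (ler_normD _ _)); apply: lerD; last exact: gN.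
by rewrite normrZ ler_wpM2l.
Qed.

HB.instance Definition _ X Y :=
  GRing.isSubmodClosed.Build K (X -> Y) bounded_linear_op
    (bounded_linear_op_submod X Y).

(* The space B(X, Y). *)
Record bop X Y := Bop {
  bop_fun :> X -> Y;
  bop_funP : bop_fun \in bounded_linear_op }.

HB.instance Definition _ X Y := [isSub of bop X Y for @bop_fun X Y].
HB.instance Definition _ X Y := [Choice of bop X Y by <:].
HB.instance Definition _ X Y := [SubChoice_isSubLmodule of bop X Y by <:].

(* The range of T is a finite-dimensional subspace of Y. *)
Definition finite_rank {X Y} (T : bop X Y) :=
  exists (n : nat) (y : 'I_n -> Y),
    range T = range (fun c : 'I_n -> K => \sum_(i < n) c i *: y i).

End bounded_operators.

Section operator_norm.
Context {k : scalar_kind} {R : realType}.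
Local Notation K := (scalars k R).
Context {X Y : normedModType K}.
Implicit Types S T : bop X Y.

Let image_ball T : set R :=
  [set real_part `|T x| | x in [set x | `|x| <= 1]].

Definition opnorm T : K := of_real (sup (image_ball T)).

Let bopD S T x : (S + T) x = S x + T x.
Proof. by []. Qed.

Let bopZ (a : K) T x : (a *: T) x = a *: T x.
Proof. by []. Qed.

Let bop_scale T (a : K) x : T (a *: x) = a *: T x.
Proof.
have /asboolP[lT _] := bop_funP T.
have T0 : T 0 = 0.
  by have := lT (-1) 0 0; rewrite scaler0 addr0 scaleN1r addNr.
by have := lT a x 0; rewrite T0 !addr0.
Qed.

Let real_norm (V : normedModType K) (v : V) : of_real (real_part `|v|) = `|v|.
Proof. exact: real_partK. Qed.

Let image_ball0 T : image_ball T (real_part `|T 0|).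
Proof. by exists 0 => //=; rewrite normr0 ler01. Qed.

Let image_ball_sup T : has_sup (image_ball T).
Proof.
split; first by exists (real_part `|T 0|).
have /asboolP[_ [M TM]] := bop_funP T.
have [M0|M0] := boolP (0 <= M).
  exists (real_part M) => _ [x /= x1 <-].
  rewrite -(@of_real_le k) real_norm real_partK//.
  by rewrite (le_trans (TM x))// ler_piMr.
exists 0 => _ [x /= x1 <-].
have [x0|x0] := eqVneq x 0.
  rewrite -(@of_real_le k) real_norm x0 of_real0.
  by rewrite (le_trans (TM 0))// normr0 mulr0.
case/negP: M0; have : 0 <= M * `|x| by exact: le_trans (TM x).
by rewrite pmulr_lge0// normr_gt0.
Qed.

Lemma opnorm_ub T x : `|x| <= 1 -> `|T x| <= opnorm T.
Proof.
move=> x1; rewrite -real_norm of_real_le.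
by apply: sup_upper_bound; [exact: image_ball_sup|exists x].
Qed.

Lemma opnorm_le T (M : K) :
  0 <= M -> (forall x, `|x| <= 1 -> `|T x| <= M) -> opnorm T <= M.
Proof.
move=> M0 TM; rewrite -(real_partK M0) of_real_le.
apply: ge_sup; first by exists (real_part `|T 0|).
by move=> _ [x /= x1 <-]; rewrite -(@of_real_le k) real_norm real_partK// TM.
Qed.

Let opnorm_ge0 T : 0 <= opnorm T.
Proof. by apply: le_trans (opnorm_ub T (x := 0) _) => //; rewrite normr0. Qed.

Let ler_opnormD S T : opnorm (S + T) <= opnorm S + opnorm T.
Proof.
apply: opnorm_le => [|x x1]; first exact: addr_ge0.
by rewrite bopD (le_trans (ler_normD _ _))// lerD// opnorm_ub.
Qed.

Let opnormZ_le (a : K) T : opnorm (a *: T) <= `|a| * opnorm T.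
Proof.
apply: opnorm_le => [|x x1]; first exact: mulr_ge0.
by rewrite bopZ normrZ ler_wpM2l// opnorm_ub.
Qed.

Let opnormZ (a : K) T : opnorm (a *: T) = `|a| * opnorm T.
Proof.
apply/eqP; rewrite eq_le opnormZ_le /=.
have [->|a0] := eqVneq a 0; first by rewrite normr0 mul0r.
rewrite -ler_pdivlMl ?normr_gt0//.
by have := opnormZ_le a^-1 (a *: T); rewrite scalerA mulVf// scale1r normfV.
Qed.

Let opnorm0_eq0 T : opnorm T = 0 -> T = 0.
Proof.
move=> T0; apply: val_inj; apply/funext => x /=.
have [->|x0] := eqVneq x 0; first by rewrite -(scale0r 0) bop_scale !scale0r.
have nx0 : `|x| != 0 by rewrite normr_eq0.
have : `|T (`|x|^-1 *: x)| <= 0.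
  by rewrite -T0 opnorm_ub// normrZ normfV normr_id mulVf.
rewrite bop_scale normr_le0 scaler_eq0 invr_eq0 (negbTE nx0) /=.
by move/eqP.
Qed.

HB.instance Definition _ :=
  Lmodule_isNormed.Build K (bop X Y) ler_opnormD opnormZ opnorm0_eq0.

End operator_norm.

Definition dual {k : scalar_kind} {R : realType}
    (X : normedModType (scalars k R)) : normedModType (scalars k R) :=
  bop X (scalars k R)^o.

Definition separable (T : topologicalType) :=
  exists2 A : set T, countable A & dense A.

Section normed_subspace.
Context {K : numFieldType} {V : normedModType K}.
Implicit Types E : submodClosed V.

(* The linear subspace E of V as a normed space, with the norm of V. *)
Record normed_sub E := NormedSub {
  normed_sub_val :> V;
  normed_subP : normed_sub_val \in E }.

HB.instance Definition _ E := [isSub of normed_sub E for @normed_sub_val E].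
HB.instance Definition _ E := [Choice of normed_sub E by <:].
HB.instance Definition _ E := [SubChoice_isSubLmodule of normed_sub E by <:].

Let sub_norm E (x : normed_sub E) : K := `|normed_sub_val x|.

Let ler_sub_normD E (x y : normed_sub E) :
  sub_norm (x + y) <= sub_norm x + sub_norm y.
Proof. exact: ler_normD. Qed.

Let sub_normZ E (a : K) (x : normed_sub E) :
  sub_norm (a *: x) = `|a| * sub_norm x.
Proof. exact: normrZ. Qed.

Let sub_norm0_eq0 E (x : normed_sub E) : sub_norm x = 0 -> x = 0.
Proof. by move=> /normr0_eq0 x0; apply: val_inj. Qed.

HB.instance Definition _ E :=
  Lmodule_isNormed.Build K (normed_sub E)
    (@ler_sub_normD E) (@sub_normZ E) (@sub_norm0_eq0 E).

End normed_subspace.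

Definition UBCP {K : numFieldType} (Z : normedModType K) :=
  exists (z : nat -> Z) (r : nat -> K) (M delta : K),
    [/\ 0 < M, 0 < delta, forall i, 0 < r i,
        [set x : Z | `|x| = 1] `<=` \bigcup_i ball (z i) (r i)
      & forall i, r i <= M /\ `|z i| - r i > delta].

Section bases.
Context {K : numFieldType} {Y : normedModType K}.
Implicit Types e : nat -> Y.

Definition schauder_basis e :=
  forall y : Y, exists! a : nat -> K, series (fun n => a n *: e n) @ \oo --> y.

Definition unconditional_bound e (C : K) :=
  1 <= C /\
  forall (a b : nat -> K) (u v : Y), (forall n, `|a n| <= `|b n|) ->
    series (fun n => a n *: e n) @ \oo --> u ->
    series (fun n => b n *: e n) @ \oo --> v ->
    `|u| <= C * `|v|.

Definition unconditional_basis e :=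
  schauder_basis e /\ exists C, unconditional_bound e C.

(* C is the best, that is the least, admissible constant. *)
Definition unconditional_constant e (C : K) :=
  unconditional_bound e C /\ forall D, unconditional_bound e D -> C <= D.

End bases.

(* Main.v *)
(* Let h = (2 - C) / 10.  Given T of norm 1, pick x in the unit ball with
   |T x| > 1 - h and n such that the n-th partial sum P_n (T x) of the basis
   expansion of T x is h-close to T x.  The finite-rank operator P_n T is
   h-close to some F = sum_(i < n) f_i (x) e_i with the f_i taken from a fixed
   countable dense subset of the dual of X.  Since I - 2 P_n only changes signs
   of coordinates, |T - 2 P_n T| <= C, hence |T - 2 F| < C + 3 h, whereas
   |2 F| > 2 - 6 h.  Thus the balls of radius C + 3 h centred at those of the
   countably many operators 2 F with |2 F| > C + 4 h witness the UBCP.  A centre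
   far from 0 is needed as a default value; it exists because X has a nonzero
   functional, by Hahn-Banach (proved with minimal sublinear functionals). *)

Require Import Defs.
From HB Require Import structures.
From mathcomp Require Import all_boot all_order all_algebra.
From mathcomp Require Import all_classical all_reals all_analysis.
From mathcomp Require Import complex ring lra.
Set Implicit Arguments.
Unset Strict Implicit.
Unset Printing Implicit Defensive.

Import Order.TTheory GRing.Theory Num.Theory.
Import numFieldNormedType.Exports.
Local Open Scope classical_set_scope.
Local Open Scope ring_scope.

(** * Real numbers inside the scalar field *)

Section of_real_theory.
Context {k : scalar_kind} {R : realType}.
Local Notation K := (scalars k R).

Lemma of_real1 : of_real 1 = 1 :> K.
Proof. by case: k. Qed.

Lemma of_realD (s t : R) : of_real (s + t) = of_real s + of_real t :> K.
Proof. by case: k => //=; rewrite /GRing.add /= addr0. Qed.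

Lemma of_realM (s t : R) : of_real (s * t) = of_real s * of_real t :> K.
Proof. by case: k => //=; rewrite /GRing.mul /= !mulr0 mul0r subr0 addr0. Qed.

Lemma of_realN (t : R) : of_real (- t) = - of_real t :> K.
Proof. by case: k => //=; rewrite /GRing.opp /= oppr0. Qed.

Lemma norm_of_real (t : R) : `|of_real t : K| = of_real `|t|.
Proof.
have [t0|t0] := leP 0 t; first by rewrite !ger0_norm// -of_real0 of_real_le.
rewrite (ltr0_norm t0) -(normrN (of_real t)) -of_realN ger0_norm//.
by rewrite -of_real0 of_real_le oppr_ge0 ltW.
Qed.

End of_real_theory.

(* Homogeneity is only required as an inequality; applied to both [t] and
   [t^-1] it gives equality. *)
Definition sublinear {k : scalar_kind} {R : realType}
    {V : lmodType (scalars k R)} (q : V -> R) :=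
  (forall x y, q (x + y) <= q x + q y) /\
  (forall t x, 0 < t -> q (of_real t *: x) <= t * q x).

(** * Minimal sublinear functionals *)

Section hahn_banach.
Context {k : scalar_kind} {R : realType} {V : lmodType (scalars k R)}.
Implicit Types (q : V -> R) (x y : V) (t : R).

Lemma sublinear0 q : sublinear q -> q 0 = 0.
Proof.
move=> [qD qZ]; have := qZ 2^-1 0 _; have := qZ 2 0 _; rewrite !scaler0.
move=> /(_ ltac:(lra)) ? /(_ ltac:(lra)); lra.
Qed.

Lemma sublinearZ q t x : sublinear q -> 0 <= t -> q (of_real t *: x) = t * q x.
Proof.
move=> sq; rewrite le_eqVlt => /orP[/eqP <-|t0].
  by rewrite of_real0 scale0r mul0r sublinear0.
have [_ qZ] := sq; apply/eqP; rewrite eq_le qZ//=.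
have := qZ t^-1 (of_real t *: x); rewrite scalerA -of_realM mulVf ?gt_eqF//.
by rewrite of_real1 scale1r invr_gt0 => /(_ t0); rewrite ler_pdivlMl.
Qed.

Lemma sublinearN q x : sublinear q -> - q (- x) <= q x.
Proof.
move=> sq; have [qD _] := sq; have := qD x (- x).
by rewrite subrr sublinear0//; lra.
Qed.

(** The last two hypotheses let a single member of [G] bound a sum or a dilation, so both
    inequalities pass to the infimum; [m] keeps the infima finite. It serves the one-parameter
    family of [sublinear_shift] and the chains in Zorn's lemma. *)
Lemma sublinear_inf (G : set (V -> R)) (m : V -> R) :
    G !=set0 -> (forall q x, G q -> m x <= q x) ->
    (forall q r, G q -> G r ->
      exists2 s, G s & forall x y, s (x + y) <= q x + r y) ->
    (forall q t, G q -> 0 < t ->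
      exists2 s, G s & forall x, s (of_real t *: x) <= t * q x) ->
  sublinear (fun x => inf [set q x | q in G]).
Proof.
move=> [q0 Gq0] mG GD GZ.
have ne x : [set q x | q in G] !=set0 by exists (q0 x), q0.
have lb q x : G q -> inf [set q x | q in G] <= q x.
  move=> Gq; apply: ge_inf; last by exists q.
  by exists (m x) => _ [r Gr <-]; exact: mG.
split=> [x y|t x t0].
  rewrite -lerBlDr; apply: lb_le_inf => // _ [q Gq <-].
  rewrite lerBlDr -lerBlDl; apply: lb_le_inf => // _ [r Gr <-].
  by have [s Gs sqr] := GD _ _ Gq Gr; rewrite lerBlDl (le_trans (lb s _ Gs)).
rewrite -ler_pdivrMl//; apply: lb_le_inf => // _ [q Gq <-].
by have [s Gs sq] := GZ _ _ Gq t0; rewrite ler_pdivrMl// (le_trans (lb s _ Gs)).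
Qed.

(** Take [q' x] to be the infimum over [t >= 0] of [q (x + t y) - t q y]. It is bounded below by
    [- q (- x)] because [t q y = q (t y) <= q (x + t y) + q (- x)]. The value [t = 0] gives
    [q' <= q], and [t = 1] gives the bound at [- y]. *)
Lemma sublinear_shift q y : sublinear q ->
  exists q', [/\ sublinear q', forall x, q' x <= q x & q' (- y) <= - q y].
Proof.
move=> sq; have [qD qZ] := sq.
pose g t x := q (x + of_real t *: y) - t * q y.
pose G := [set g t | t in [set t | 0 <= t]].
have mG x t : 0 <= t -> - q (- x) <= g t x.
  move=> t0; have := qD (x + of_real t *: y) (- x).
  rewrite addrAC subrr add0r sublinearZ// /g; lra.
have lb x t : 0 <= t -> inf [set r x | r in G] <= g t x.
  move=> t0; apply: ge_inf; last by exists (g t) => //; exists t.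
  by exists (- q (- x)) => _ [_ [s s0 <-] <-]; exact: mG.
exists (fun x => inf [set r x | r in G]); split.
- apply: (sublinear_inf (m := fun x => - q (- x))).
  + by exists (g 0), 0 => /=.
  + by move=> _ x [t /= t0 <-]; exact: mG.
  + move=> _ _ [s /= s0 <-] [t /= t0 <-].
    exists (g (s + t)); first by exists (s + t) => //=; exact: addr_ge0.
    move=> x z; rewrite /g of_realD scalerDl addrACA.
    have := qD (x + of_real s *: y) (z + of_real t *: y); lra.
  + move=> _ t [s /= s0 <-] t0.
    exists (g (t * s)); first by exists (t * s) => //=; rewrite mulr_ge0// ltW.
    move=> x; rewrite /g of_realM -scalerA -scalerDr mulrBr mulrA lerB//.
    exact: qZ.
- move=> x; apply: le_trans (lb x 0 _) _ => //.
  by rewrite /g of_real0 scale0r mul0r addr0 subr0.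
- apply: le_trans (lb _ 1 _) _ => //.
  by rewrite /g of_real1 scale1r mul1r addNr sublinear0// sub0r.
Qed.

(* A minimal sublinear functional [f] is real-linear: by [sublinear_shift] and
   minimality, [f (- y) <= - f y]. *)
Lemma sublinear_minimal (p : V -> R) : sublinear p ->
  exists f, [/\ sublinear f, forall x, f x <= p x & forall x, f (- x) = - f x].
Proof.
move=> sp; pose P q := sublinear q /\ forall x, q x <= p x.
pose T := {q | P q}.
(* The order is reversed, so that a maximal element for Zorn is a minimal functional. *)
pose below (u v : T) := `[< forall x, sval v x <= sval u x >].
have [||||[f [sf fp]] fmin] := @Zorn T below.
- by move=> u; apply/asboolP.
- move=> v u w /asboolP uv /asboolP vw; apply/asboolP => x.
  exact: le_trans (vw x) (uv x).
- move=> [u Pu] [v Pv] /asboolP uv /asboolP vu; apply: eq_exist.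
  by apply/funext => x; apply/eqP; rewrite eq_le uv vu.
- move=> A totA; have [[u0 Au0]|A0] := pselect (A !=set0); last first.
    exists (exist P p (conj sp (fun x => lexx _))) => u Au.
    by case: A0; exists u.
  pose G := [set sval u | u in A].
  have mG q x : G q -> - p (- x) <= q x.
    move=> [[r [sr rp]] _ <-]/=; apply: le_trans (sublinearN _ sr).
    by rewrite lerN2.
  have lb u x : A u -> inf [set r x | r in G] <= sval u x.
    move=> Au; apply: ge_inf; last by exists (sval u) => //; exists u.
    by exists (- p (- x)) => _ [q Gq <-]; exact: mG.
  have sinf : sublinear (fun x => inf [set r x | r in G]).
    apply: (sublinear_inf (m := fun x => - p (- x))) => //.
    + by exists (sval u0), u0.
    + move=> _ _ [u Au <-] [v Av <-].
      (* In a chain, the pointwise smaller of the two functionals bounds the sum. *)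
      have [/asboolP uv|/asboolP vu] := totA _ _ Au Av.
      * exists (sval v); [by exists v|move=> x y].
        by have [[vD _] _] := svalP v; rewrite (le_trans (vD _ _))// lerD2r.
      * exists (sval u); [by exists u|move=> x y].
        by have [[uD _] _] := svalP u; rewrite (le_trans (uD _ _))// lerD2l.
    + move=> _ t [u Au <-] t0; exists (sval u); first by exists u.
      by have [[_ uZ] _] := svalP u => x; exact: uZ.
  have infp x : inf [set r x | r in G] <= p x.
    by apply: le_trans (lb u0 x Au0) _; have [_] := svalP u0; exact.
  exists (exist P _ (conj sinf infp)) => u Au.
  by apply/asboolP => x; exact: lb.
exists f; split => // x.
have [q [sq qf qx]] := sublinear_shift x sf.
have qp y : q y <= p y by exact: le_trans (qf y) (fp y).
have [qE] : exist P q (conj sq qp) = exist P f (conj sf fp) :> T.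
  by apply: fmin; apply/asboolP.
by rewrite qE in qx; apply/eqP; rewrite eq_le qx lerNl sublinearN.
Qed.

Lemma sublinear_odd (f : V -> R) : sublinear f -> (forall x, f (- x) = - f x) ->
  {morph f : x y / x + y} /\ forall t x, f (of_real t *: x) = t * f x.
Proof.
move=> sf fN; have [fD _] := sf; split=> [x y|t x].
  apply/eqP; rewrite eq_le fD/=.
  have := fD (- x) (- y); rewrite -opprD !fN; lra.
have [t0|t0] := leP 0 t; first exact: sublinearZ.
rewrite -[t]opprK of_realN scaleNr fN sublinearZ//; first by rewrite !mulNr.
by rewrite oppr_ge0 ltW.
Qed.

End hahn_banach.

(** * Real-linear functionals dominated by the norm *)

Section nonzero_functional.
Context {k : scalar_kind} {R : realType} (X : normedModType (scalars k R)).
Local Notation K := (scalars k R).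

Lemma norm_real_part (x : X) : of_real (real_part `|x|) = `|x|.
Proof. exact: real_partK. Qed.

Lemma sublinear_norm : sublinear (fun x : X => real_part `|x|).
Proof.
split=> [x y|t x t0].
  by rewrite -(of_real_le (k := k)) of_realD !norm_real_part ler_normD.
rewrite -(of_real_le (k := k)) of_realM !norm_real_part normrZ norm_of_real.
by rewrite gtr0_norm.
Qed.

(** The norm is first shifted at [x0] to some [p] with [p (- x0) <= - |x0|]. An odd [f] below [p]
    then satisfies [- f x0 = f (- x0) <= - |x0|], so [f x0 >= |x0| > 0]. *)
Lemma exists_real_functional (x0 : X) : x0 != 0 ->
  exists f : X -> R, [/\ {morph f : x y / x + y},
    forall t x, f (of_real t *: x) = t * f x,
    forall x, `|f x| <= real_part `|x| & f x0 != 0].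
Proof.
move=> x00; have [p [sp pn px0]] := sublinear_shift x0 sublinear_norm.
have [f [sf fp fN]] := sublinear_minimal sp.
have [fD fZ] := sublinear_odd sf fN.
have fn x : f x <= real_part `|x| by exact: le_trans (fp x) (pn x).
exists f; split => //.
  by move=> x; rewrite ler_norml fn lerNl -fN -normrN fn.
have : 0 < real_part `|x0|.
  rewrite lt_neqAle -(of_real_le (k := k)) norm_real_part of_real0 normr_ge0.
  by rewrite andbT; apply: contra_neq x00 => n0; apply: normr0_eq0;
    rewrite -norm_real_part -n0 of_real0.
by have := fp (- x0); rewrite fN; have := px0; rewrite /=; lra.
Qed.

End nonzero_functional.

(** * From real-linear to complex-linear functionals *)

Section complexification.
Local Open Scope complex_scope.

(* A complex-linear functional is determined by its real part [f], as
   [x |-> f x - i f (i x)]. *)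
Lemma complex_functional {R : realType} (X : normedModType R[i]) (f : X -> R) :
    {morph f : x y / x + y} -> (forall t x, f (t%:C *: x) = t * f x) ->
    (forall x, `|f x|%:C <= `|x|) ->
  exists g : X -> R[i],
    [/\ forall a x y, g (a *: x + y) = a * g x + g y,
        forall x, `|g x| <= 2 * `|x| & forall x, complex.Re (g x) = f x].
Proof.
move=> fD fZ fn; pose J : R[i] := 'i%C.
have JJ : J * J = (-1)%:C by rewrite -expr2 sqr_i rmorphN1.
have nJ : `|J| = 1 by rewrite normc_def /= expr0n expr1n add0r sqrtr1.
have nC (t : R) : `|t%:C| = `|t|%:C.
  by rewrite normc_def /= expr0n addr0 sqrtr_sqr.
pose g x := (f x)%:C - J * (f (J *: x))%:C.
have gD : {morph g : x y / x + y}.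
  by move=> x y; rewrite /g scalerDr !fD !rmorphD mulrDr opprD addrACA.
have gZ t x : g (t%:C *: x) = t%:C * g x.
  rewrite /g scalerA [J * t%:C]mulrC -scalerA !fZ !rmorphM mulrBr.
  by rewrite (mulrCA J).
have gJ x : g (J *: x) = J * g x.
  rewrite /g scalerA JJ fZ mulN1r rmorphN mulrN opprK mulrBr mulrA JJ.
  by rewrite rmorphN1 mulN1r opprK addrC.
exists g; split=> [a x y|x|x].
- rewrite gD; congr (_ + _); rewrite [a]complexE -/J.
  by rewrite scalerDl gD gZ -scalerA gJ gZ mulrDl mulrA.
- rewrite (le_trans (ler_normD _ _))// normrN normrM nJ mul1r !nC.
  by rewrite mulr_natl mulr2n lerD// (le_trans (fn _))// normrZ nJ mul1r.
- by rewrite /g /J /=; ring.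
Qed.

End complexification.

Lemma exists_nonzero_functional {k : scalar_kind} {R : realType}
    (X : normedModType (scalars k R)) :
  (exists x : X, x != 0) -> exists f : dual X, exists x, f x != 0.
Proof.
move=> [x0 x00]; have [f [fD fZ fn fx0]] := exists_real_functional x00.
case: k X x0 x00 f fD fZ fn fx0 => X x0 _ f fD fZ fn fx0.
  have fP : (f : X -> R^o) \in bounded_linear_op.
    apply/asboolP; split=> [a x y|]; first by rewrite fD fZ.
    by exists 1 => x; rewrite mul1r; exact: fn.
  by exists (Bop fP), x0.
have fn' x : (Complex `|f x| 0 : R[i]) <= `|x|.
  by have := fn x; rewrite -(@of_real_le ComplexScalars R) norm_real_part.
have [g [gL gn gf]] := @complex_functional R X f fD fZ fn'.
have gP : (g : X -> (scalars ComplexScalars R)^o) \in bounded_linear_op.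
  by apply/asboolP; split; [exact: gL|exists 2].
exists (Bop gP), x0; apply: contra_neq fx0 => /= gx0.
by rewrite -gf gx0.
Qed.

(** * Coordinates with respect to an unconditional basis *)

Section basis_coordinates.
Context {K : numFieldType} {Y : normedModType K}.
Implicit Types (e : nat -> Y) (c : Y -> nat -> K).

(** The equivalence packs both halves of the basis property: right to left is convergence of the
    expansion, left to right its uniqueness. *)
Definition coordinates e c :=
  forall y a, series (fun n => a n *: e n) @ \oo --> y <-> a = c y.

Lemma schauder_coordinates e :
  schauder_basis e -> exists c, coordinates e c.
Proof.
move=> /choice[c cP]; exists c => y a; have [cy cU] := cP y.
by split=> [/cU ->|->].
Qed.

Lemma cvg_series_support (n : nat) (u : nat -> Y) :
  (forall i, (n <= i)%N -> u i = 0) -> series u @ \oo --> \sum_(i < n) u i.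
Proof.
move=> u0; apply: cvg_near_cst; exists n => // m /= nm.
rewrite /series /= (big_cat_nat (leq0n n) nm)/= [X in _ + X]big1_seq.
  by rewrite addr0 big_mkord.
by move=> i /andP[_]; rewrite mem_index_iota => /andP[ni _]; exact: u0.
Qed.

Lemma coordinates_cvg e c y :
  coordinates e c -> series (fun n => c y n *: e n) @ \oo --> y.
Proof. by move=> eP; apply: (eP _ _).2. Qed.

Lemma coordinates_linear e c n : coordinates e c -> scalar (c ^~ n).
Proof.
move=> eP a x y; suff <- : (fun n => a * c x n + c y n) = c (a *: x + y) by [].
apply: (eP _ _).1; have -> : (fun n => (a * c x n + c y n) *: e n) =
    a *: (fun n => c x n *: e n) + (fun n => c y n *: e n).
  by apply/funext => m; rewrite scalerDl -scalerA.
rewrite seriesD seriesZ; apply: cvgD; last exact: coordinates_cvg.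
by apply: cvgZr; exact: coordinates_cvg.
Qed.

(** If [e n] vanished, the zero sequence and the [n]-th unit sequence would both expand 0. *)
Lemma basis_neq0 e c n : coordinates e c -> e n != 0.
Proof.
move=> eP; apply/eqP => en0.
have cvg0 (a : nat -> K) :
    (forall i, a i *: e i = 0) ->
    series (fun i => a i *: e i) @ \oo --> (0 : Y).
  move=> a0.
  have := @cvg_series_support 0 (fun i => a i *: e i) (fun i _ => a0 i).
  by rewrite big_ord0.
have /((eP _ _).1) h0 := cvg0 (fun=> 0) (fun i => scale0r _).
have /((eP _ _).1) h1 : series (fun i => (i == n)%:R *: e i) @ \oo --> (0 : Y).
  by apply: (cvg0) => i; case: eqP => [->|]; rewrite ?en0 ?scaler0 ?scale0r.
have := congr1 (@^~ n) (etrans h0 (esym h1)); rewrite eqxx => /eqP.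
by rewrite eq_sym oner_eq0.
Qed.

(** The sequence keeping only the [n]-th coordinate of [y] is dominated by [c y]. This makes the
    coordinate functionals bounded. *)
Lemma coordinate_bound e c C y n : coordinates e c -> unconditional_bound e C ->
  `|c y n| * `|e n| <= C * `|y|.
Proof.
move=> eP [_ Cb]; rewrite -normrZ.
pose a (i : nat) := if i == n then c y n else 0.
refine (Cb a (c y) _ y _ _ (coordinates_cvg eP)) => [i|].
  by rewrite /a; case: (eqVneq i n) => [->//|_]; rewrite normr0.
have -> : c y n *: e n = \sum_(i < n.+1) a i *: e i.
  rewrite big_ord_recr big1/= => [|i _]; first by rewrite /a eqxx add0r.
  by rewrite /a ltn_eqF// scale0r.
by apply: cvg_series_support => i ni; rewrite /a gtn_eqF// scale0r.
Qed.

(* [y - 2 P_n y] is [y] with the signs of its first [n] coordinates changed. *)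
Lemma reflection_bound e c C y n : coordinates e c -> unconditional_bound e C ->
  `|y - 2 *: \sum_(i < n) c y i *: e i| <= C * `|y|.
Proof.
move=> eP [_ Cb].
pose b (i : nat) := if (i < n)%N then - c y i else c y i.
refine (Cb b (c y) _ y _ _ (coordinates_cvg eP)) => [i|].
  by rewrite /b; case: ifP; rewrite ?normrN.
pose d i := (if (i < n)%N then c y i else 0) *: e i.
have -> : (fun i => b i *: e i) = (fun i => c y i *: e i) - 2 *: d.
  apply/funext => i; rewrite -[RHS]/(c y i *: e i - 2 *: d i) /b /d.
  case: ifP => _; last by rewrite scale0r scaler0 subr0.
  by rewrite scaleNr scaler_nat mulr2n opprD addrA subrr sub0r.
rewrite seriesD seriesN seriesZ; apply: cvgB; first exact: coordinates_cvg.
apply: cvgZr.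
have -> : \sum_(i < n) c y i *: e i = \sum_(i < n) d i.
  by apply: eq_bigr => i _; rewrite /d ltn_ord.
apply: cvg_series_support => i; rewrite /d leqNgt => /negbTE ->.
by rewrite scale0r.
Qed.

End basis_coordinates.

(** * Bounded operators, rank-one operators and the operator norm *)

Section bounded_operators_facts.
Context {K : numFieldType} {X Y : normedModType K}.

Lemma bopP (T : bop X Y) (a : K) x y : T (a *: x + y) = a *: T x + T y.
Proof. by have /asboolP[lT _] := bop_funP T; exact: lT. Qed.

Lemma bop0 (T : bop X Y) : T 0 = 0.
Proof. by have := bopP T (-1) 0 0; rewrite scaler0 addr0 scaleN1r addNr. Qed.

Lemma bopZ (T : bop X Y) (a : K) x : T (a *: x) = a *: T x.
Proof. by have := bopP T a x 0; rewrite bop0 !addr0. Qed.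

Lemma bop_sum (I : Type) (s : seq I) (P : pred I) (T : I -> bop X Y) x :
  (\sum_(i <- s | P i) T i) x = \sum_(i <- s | P i) T i x.
Proof. by elim/big_ind2 : _ => // f a g b <- <-. Qed.

End bounded_operators_facts.

Section rank_one_operators.
Context {K : numFieldType} {X Y : normedModType K}.

Lemma rank_one_subproof (f : bop X K^o) (y : Y) :
  (fun x => f x *: y) \in bounded_linear_op.
Proof.
apply/asboolP; split=> [a u v|]; first by rewrite /= bopP scalerDl -scalerA.
have /asboolP[_ [M fM]] := bop_funP f; exists (M * `|y|) => x.
by rewrite normrZ mulrAC ler_wpM2r.
Qed.

Definition rank_one (f : bop X K^o) (y : Y) : bop X Y :=
  Bop (rank_one_subproof f y).

Lemma finite_rank_rank_one (f : bop X K^o) (y : Y) : finite_rank (rank_one f y).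
Proof.
have [[x fx0]|f0] := pselect (exists x, f x != 0).
  exists 1, (fun=> y); apply/seteqP; split=> [_ [u _ <-]|_ [c _ <-]].
    by exists (fun=> f u) => //; rewrite big_ord1.
  rewrite big_ord1; exists ((c ord0 / f x) *: x) => //=.
  by rewrite bopZ -[_ *: f x]/(_ * f x) divfK.
(* When [f] vanishes, the range is zero, the span of the empty family. *)
exists 0, (fun=> 0); apply/seteqP; split=> [_ [u _ <-]|_ [u _ <-]].
  exists (fun=> 0); rewrite // big_ord0 /=.
  have -> : f u = 0 by apply/eqP/negPn/negP => fu0; apply: f0; exists u.
  by rewrite scale0r.
by exists 0 => //; rewrite big_ord0 /= bop0 scale0r.
Qed.

End rank_one_operators.

Section opnorm_facts.
Context {k : scalar_kind} {R : realType}.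
Local Notation K := (scalars k R).
Context {X Y : normedModType K}.
Implicit Types T : bop X Y.

Lemma bop_norm_ub T x : `|x| <= 1 -> `|T x| <= `|T|.
Proof. exact: opnorm_ub. Qed.

Lemma bop_norm_le T (M : K) :
  0 <= M -> (forall x, `|x| <= 1 -> `|T x| <= M) -> `|T| <= M.
Proof. exact: opnorm_le. Qed.

Lemma bop_norm_approx T (M : K) : 0 <= M -> M < `|T| ->
  exists2 x, `|x| <= 1 & M < `|T x|.
Proof.
move=> M0 MT; have [//|nx] := pselect (exists2 x, `|x| <= 1 & M < `|T x|).
(* The order on the scalars need not be total, but norms and [M] are real and hence comparable. *)
suff : `|T| <= M by move=> TM; have := lt_le_trans MT TM; rewrite ltxx.
apply: bop_norm_le => // x x1; rewrite real_leNgt ?normr_real ?ger0_real//.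
by apply/negP => Mx; apply: nx; exists x.
Qed.

End opnorm_facts.

Lemma separable_sequence (K : numFieldType) (V : normedModType K) :
  separable V -> exists d : nat -> V,
    forall v (r : K), 0 < r -> exists n, `|v - d n| < r.
Proof.
move=> [A /countable_injP[h hA] dA].
(* The sequence inverts the injection [h] on [A], with value 0 at indices that [h] does not
   reach. *)
exists (fun n => xget 0 [set a | A a /\ h a = n]) => v r r0.
have [||a [/=]] := dA (ball v r) _ _.
- by exists v; exact: ballxx.
- exact: ball_open.
rewrite -ball_normE /= => va Aa; exists (h a).
case: xgetP => [b _ [Ab hb]|/(_ a) []//].
by have -> : b = a by apply: hA; rewrite ?inE.
Qed.

(** * Approximation by countably many finite-rank operators *)

Section UBCP_operators.
Context {k : scalar_kind} {R : realType}.
Local Notation K := (scalars k R).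
Context {X Y : normedModType K} (e : nat -> Y) (c : Y -> nat -> K) (C : K).
Context (eP : coordinates e c) (Cb : unconditional_bound e C).

Lemma coordinate_subproof (T : bop X Y) n :
  ((fun x => c (T x) n) : X -> K^o) \in bounded_linear_op.
Proof.
apply/asboolP; split=> [a x y|].
  by rewrite bopP; exact: (coordinates_linear n eP).
have /asboolP[_ [M TM]] := bop_funP T; have [C1 _] := Cb.
have e0 : 0 < `|e n| by rewrite normr_gt0 (basis_neq0 _ eP).
exists (C * M / `|e n|) => x.
rewrite mulrAC ler_pdivlMr// (le_trans (coordinate_bound _ _ eP Cb))// -mulrA.
by rewrite ler_wpM2l// (le_trans ler01).
Qed.

Definition coordinate (T : bop X Y) n : dual X := Bop (coordinate_subproof T n).

(** The functionals form a list because lists over a countable set are countable; the length of the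
    list is the number of basis vectors used. *)
Definition combination (s : seq (dual X)) : bop X Y :=
  \sum_(i < size s) rank_one (nth 0 s i) (e i).

Lemma combination_approx (d : nat -> dual X) (T : bop X Y) n (h : K) :
    (forall f (r : K), 0 < r -> exists m, `|f - d m| < r) -> 0 < h ->
  exists s : seq nat, forall x, `|x| <= 1 ->
    `|\sum_(i < n) c (T x) i *: e i - combination (map d s) x| <= h.
Proof.
move=> dd h0.
(* With this tolerance each of the [n] terms has error at most [h / n.+1], hence [h] in total;
   [n.+1] keeps it positive when [n = 0]. *)
have r0 i : 0 < h / n.+1%:R / `|e i|.
  by rewrite !divr_gt0// normr_gt0 (basis_neq0 _ eP).
have /choice[m md] i := dd (coordinate T i) _ (r0 i).
exists (mkseq m n) => x x1; rewrite bop_sum !size_map size_iota -sumrB.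
apply: (@le_trans _ _ (\sum_(i < n) h / n.+1%:R)); last first.
  rewrite sumr_const card_ord -[leLHS]mulr_natr mulrAC ler_pdivrMr//.
  by rewrite ler_wpM2l ?ler_nat// ltW.
apply: (le_trans (ler_norm_sum _ _ _)); apply: ler_sum => i _ /=.
rewrite (nth_map 0%N) ?size_mkseq// nth_mkseq// -scalerBl normrZ.
rewrite -ler_pdivlMr ?normr_gt0 ?(basis_neq0 _ eP)//.
exact: le_trans (bop_norm_ub (coordinate T i - d (m i)) x1) (ltW (md i)).
Qed.

Lemma combination_ball (d : nat -> dual X) (T : bop X Y) (h : K) :
    (forall f (r : K), 0 < r -> exists m, `|f - d m| < r) ->
    0 < h -> C + h *+ 10 = 2 -> `|T| = 1 ->
  exists s : seq nat, let F := 2 *: combination (map d s) in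
    `|F - T| < C + h *+ 3 /\ h < `|F| - (C + h *+ 3).
Proof.
move=> dd h0 Ch T1; have [C1 _] := Cb.
have C0 : 0 <= C by rewrite (le_trans ler01).
have h1 : 0 <= 1 - h.
  have -> : 1 - h = (C - 1) + h *+ 9.
    by have -> : C = 2 - h *+ 10; [rewrite -Ch; ring|ring].
  by rewrite addr_ge0 ?subr_ge0// mulrn_wge0// ltW.
have [|x x1 Tx] := bop_norm_approx h1 (T := T); first by rewrite T1 gtrBl.
have /cvgrPdist_lt/(_ h h0)[n _ /(_ n (leqnn n)) nTx] :=
  coordinates_cvg (y := T x) eP.
move: nTx; rewrite /series /= big_mkord => nTx.
have [s sT] := combination_approx T n dd h0.
exists s; cbv zeta; set F := 2 *: _.
have FE z : F z = 2 *: combination (map d s) z by [].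
have TF : `|F - T| <= C + h *+ 2.
  apply: bop_norm_le => [|z z1]; first by rewrite addr_ge0// mulrn_wge0// ltW.
  rewrite -[(F - T) z]/(F z - T z) distrC FE.
  set p := \sum_(i < n) c (T z) i *: e i.
  (* Although [n] was chosen for the single point [x], this bound holds at every [z]: the reflection
     [T z - 2 p] costs [C], and replacing [p] by the combination costs [2 h]. *)
  rewrite -(subrKA (2 *: p)) (le_trans (ler_normD _ _))// lerD//.
    rewrite (le_trans (reflection_bound _ _ eP Cb))//.
    by rewrite ler_piMr// -T1 bop_norm_ub.
  rewrite -scalerBr normrZ -[leRHS]mulr_natl ger0_norm ?ler0n//.
  by rewrite ler_wpM2l ?ler0n// sT.
split; first by rewrite (le_lt_trans TF)// ltrD2l ltr_pMn2l.
set p := \sum_(i < n) c (T x) i *: e i in nTx.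
set w := combination (map d s) x in FE *.
have Fx : 2 * `|w| <= `|F|.
  by rewrite -[2]ger0_norm ?ler0n// -normrZ -FE bop_norm_ub.
have px : `|T x| <= h + (h + `|w|).
  have -> : T x = (T x - p) + ((p - w) + w) by rewrite !subrK.
  rewrite (le_trans (ler_normD _ _))// lerD ?(ltW nTx)//.
  by rewrite (le_trans (ler_normD _ _))// lerD2r sT.
(* From [1 - h < |T x| <= 2 h + |w|] follows [|F| >= 2 |w| > 2 - 6 h], which equals [C + 4 h] by the
   choice of [h]. *)
rewrite ltrBrDr; apply: lt_le_trans Fx; rewrite -(ltrD2r (h *+ 6)).
have -> : h + (C + h *+ 3) + h *+ 6 = 2 * 1 by rewrite mulr1 -Ch; ring.
have -> : 2 * `|w| + h *+ 6 = 2 * (h + (h + `|w|) + h) by ring.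
by rewrite ltr_pM2l ?ltr0n// -ltrBlDr (lt_le_trans Tx).
Qed.

End UBCP_operators.

(** * The covering of the unit sphere of [E] *)

Theorem theorem3p1 (k : scalar_kind) (R : realType)
    (X Y : completeNormedModType (scalars k R))
    (X_nontrivial : exists x : X, x != 0)
    (dual_separable : separable (dual X))
    (e : nat -> Y) (C : scalars k R)
    (e_unconditional : unconditional_basis e)
    (C_constant : unconditional_constant e C)
    (C_lt2 : C < 2)
    (E : submodClosed (bop X Y))
    (finite_rank_E : forall T : bop X Y, finite_rank T -> T \in E) :
  UBCP (normed_sub E).
Proof.
have [[/schauder_coordinates[c eP] _] [Cb _]] := (e_unconditional, C_constant).
have [d dd] := separable_sequence dual_separable.
pose h : scalars k R := (2 - C) / 10.
have h0 : 0 < h by rewrite divr_gt0 ?subr_gt0.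
have Ch : C + h *+ 10 = 2.
  by rewrite -[h *+ 10]mulr_natr divfK ?pnatr_eq0// addrC subrK.
have C0 : 0 < C by have [C1 _] := Cb; rewrite (lt_le_trans ltr01).
pose r := C + h *+ 3.
have r0 : 0 < r by rewrite addr_gt0// mulrn_wgt0.
(* Closure of [E] under sums and scalings reduces membership to rank-one operators. *)
have EF s : 2 *: combination e s \in E.
  apply/rpredZ/rpred_sum => i _; exact/finite_rank_E/finite_rank_rank_one.
have [z0 z0r] : exists z : normed_sub E, h < `|z| - r.
  have [f [x fx0]] := exists_nonzero_functional X_nontrivial.
  pose T := rank_one f (e 0%N).
  have T0 : 0 < `|T|.
    rewrite normr_gt0; apply/eqP => /(congr1 (fun S : bop X Y => S x)) /eqP.
    by rewrite scaler_eq0 (negbTE fx0) (negbTE (basis_neq0 _ eP)).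
  (* The scaling gives norm [2 (h + r)], which exceeds [h + r]. *)
  have ET : ((2 * (h + r)) / `|T|) *: T \in E.
    exact/rpredZ/finite_rank_E/finite_rank_rank_one.
  exists (NormedSub ET).
  rewrite ltrBrDr -[ltRHS]/(`|((2 * (h + r)) / `|T|) *: T|) normrZ.
  have hr : 0 < h + r by rewrite addr_gt0.
  rewrite ger0_norm ?divfK ?gt_eqF//; last by rewrite divr_ge0// mulr_ge0// ltW.
  by rewrite ltr_pMl// ltr1n.
pose G (s : seq nat) : normed_sub E := NormedSub (EF (map d s)).
(* Naturals encode lists of indices into [d]. The default [z0] replaces numbers that encode no list
   and operators too close to 0, so the lower bound holds for every [i]. *)
pose z i := if unpickle i is Some s then
  (if h < `|G s| - r then G s else z0) else z0.
exists z, (fun=> r), r, h; split => //.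
- move=> T T1.
  have [s [sT sr]] :=
    combination_ball (T := normed_sub_val T) eP Cb dd h0 Ch T1.
  exists (pickle s); first exact: I.
  rewrite /z pickleK.
  have -> : h < `|G s| - r by exact: sr.
  rewrite -ball_normE; exact: sT.
- move=> i; split=> //; rewrite /z; case: unpickle => // s.
  by case: ifP.
Qed.
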